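(* Let $\mathcal{A}\in\mathbb{C}^{\mathbf{I}(N)\times\mathbf{I}(N)}$. Then $\mathcal{A}$ has a unique decomposition $\mathcal{A}=\mathcal{B}+\mathcal{N}$ such that $\mathcal{B}$ is of index $1$, $\mathcal{N}$ is nilpotent, and $\mathcal{N}*_N\mathcal{B}=\mathcal{B}*_N\mathcal{N}=\mathcal{O}$. Further, $(\mathcal{A}^{D})^{\#}=\mathcal{B}$.
   Context: For positive integers $I_1,\dots,I_N$ write $\mathbf{I}(N)=I_1\times\cdots\times I_N$; $\mathbb{C}^{\mathbf{I}(N)\times\mathbf{J}(N)}$ is the set of complex tensors with entries $a_{i_1\dots i_N j_1\dots j_N}$, $1\le i_s\le I_s$, $1\le j_s\le J_s$. The Einstein product of $\mathcal{A}\in\mathbb{C}^{\mathbf{I}(N)\times\mathbf{K}(N)}$ and $\mathcal{B}\in\mathbb{C}^{\mathbf{K}(N)\times\mathbf{J}(N)}$ is $(\mathcal{A}*_N\mathcal{B})_{i_1\dots i_N j_1\dots j_N}=\sum_{k_1,\dots,k_N}a_{i_1\dots i_N k_1\dots k_N}b_{k_1\dots k_N j_1\dots j_N}$; similarly $\mathcal{A}*_N\mathcal{X}\in\mathbb{C}^{\mathbf{I}(N)}$ for $\mathcal{X}\in\mathbb{C}^{\mathbf{K}(N)}$. Powers of $\mathcal{A}\in\mathbb{C}^{\mathbf{I}(N)\times\mathbf{I}(N)}$ are taken with $*_N$, $\mathcal{A}^0=\mathcal{I}$ is the identity tensor, and $\mathcal{O}$ is the zero tensor. In the decomposition, $\mathcal{B},\mathcal{N}\in\mathbb{C}^{\mathbf{I}(N)\times\mathbf{I}(N)}$.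 A tensor $\mathcal{N}$ is nilpotent if $\mathcal{N}^m=\mathcal{O}$ for some positive integer $m$. The range of $\mathcal{A}$ is $\mathfrak{R}(\mathcal{A})=\{\mathcal{A}*_N\mathcal{X}:\mathcal{X}\in\mathbb{C}^{\mathbf{I}(N)}\}$. The index $\mathrm{ind}(\mathcal{A})$ is the smallest nonnegative integer $k$ with $\mathfrak{R}(\mathcal{A}^k)=\mathfrak{R}(\mathcal{A}^{k+1})$. The Drazin inverse $\mathcal{A}^D$ of $\mathcal{A}$ with $\mathrm{ind}(\mathcal{A})=k$ is the (unique, always existing) tensor $\mathcal{X}\in\mathbb{C}^{\mathbf{I}(N)\times\mathbf{I}(N)}$ with $\mathcal{A}^{k+1}*_N\mathcal{X}=\mathcal{A}^k$, $\mathcal{X}*_N\mathcal{A}*_N\mathcal{X}=\mathcal{X}$, $\mathcal{A}*_N\mathcal{X}=\mathcal{X}*_N\mathcal{A}$. When $k=1$, $\mathcal{A}^D$ is called the group inverse of $\mathcal{A}$ and denoted $\mathcal{A}^{\#}$.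
   Formalization: For invertible A the claim fails (A = I forces B of index 0), so ''index 1'' is read as index at most 1, for B and in the group inverse; when A has positive index, B and the Drazin inverse of A are shown to have index exactly 1. *)

(* Defs.v *)
From HB Require Import structures.
From mathcomp Require Import all_boot all_order all_algebra.
From mathcomp Require Import complex.
From mathcomp Require Import boolp classical_sets reals.

Set Implicit Arguments.
Unset Strict Implicit.
Unset Printing Implicit Defensive.

Import GRing.Theory.
Local Open Scope ring_scope.

(* Multi-indices (i_1, ..., i_N) with i_s ranging over I_s values; as usual
   they are numbered from 0 instead of 1. *)
Notation mindex I := {dffun forall s, 'I_(I s)}.

(* tensor F I J is F^(I(N) x J(N)), hyper F I is F^(I(N)). *)
Notation tensor F I J := {ffun mindex I * mindex J -> F}.
Notation hyper F I := {ffun mindex I -> F}.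

Section Tensors.
Variables (F : fieldType) (N : nat).
Implicit Types I J K : 'I_N -> nat.

Definition einstein I K J (A : tensor F I K) (B : tensor F K J) :
  tensor F I J :=
  [ffun p => \sum_(k : mindex K) A (p.1, k) * B (k, p.2)].

Definition tapply I K (A : tensor F I K) (X : hyper F K) : hyper F I :=
  [ffun i => \sum_(k : mindex K) A (i, k) * X k].

Definition tid I : tensor F I I := [ffun p => (p.1 == p.2)%:R].

Definition tpow I (A : tensor F I I) (m : nat) : tensor F I I :=
  iter m (einstein A) (tid I).

Definition tnilpotent I (A : tensor F I I) : Prop :=
  exists2 m : nat, (0 < m)%N & tpow A m = 0.

Definition trange I (A : tensor F I I) : set (hyper F I) := range (tapply A).

Definition is_index I (A : tensor F I I) (k : nat) : Prop :=
  trange (tpow A k) = trange (tpow A k.+1) /\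
  forall j : nat, (j < k)%N -> trange (tpow A j) <> trange (tpow A j.+1).

(* The default value 0 is never used: the ranges of the powers of A form a
   decreasing chain of subspaces of a finite-dimensional space. *)
Definition tindex I (A : tensor F I I) : nat := xget 0%N (is_index A).

Definition is_drazin I (A X : tensor F I I) : Prop :=
  [/\ einstein (tpow A (tindex A).+1) X = tpow A (tindex A),
      einstein (einstein X A) X = X
    & einstein A X = einstein X A].

(* The default value 0 is never used: every A has exactly one Drazin
   inverse. *)
Definition drazin I (A : tensor F I I) : tensor F I I := xget 0 (is_drazin A).

(* An invertible tensor has index 0 with the above definition, so "of index 1"
   has to include index 0 for the group inverse of an invertible tensor and
   for the core part of an invertible tensor (the tensor itself) to make
   sense. *)
Definition index_le1 I (A : tensor F I I) : Prop := (tindex A <= 1)%N.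

Definition is_group_inverse I (A X : tensor F I I) : Prop :=
  index_le1 A /\ drazin A = X.

Definition core_nilpotent_decomposition I (A B N : tensor F I I) : Prop :=
  [/\ A = B + N, index_le1 B, tnilpotent N,
      einstein N B = 0 & einstein B N = 0].

End Tensors.

(* Main.v *)
(* The tensors with the Einstein product form a matrix ring, in which the index
   of a is at most k iff a^k = a^(k+1) y for some y.  By Cayley-Hamilton such a y
   exists for some k and can be chosen to commute with a, which yields the Drazin
   inverse d = a^k y^(k+1); everything else is ring theory.  The core part is
   b = a d a, and conversely the Drazin inverse of the core part of any
   core-nilpotent decomposition is a Drazin inverse of a, hence equals d. *)
Require Import Defs.
From HB Require Import structures.
From mathcomp Require Import all_boot all_order all_algebra.
From mathcomp Require Import complex.
From mathcomp Require Import boolp classical_sets reals.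
Import GRing.Theory.

Set Implicit Arguments.
Unset Strict Implicit.
Unset Printing Implicit Defensive.

Local Open Scope ring_scope.

(** * Drazin inverses in an arbitrary ring *)

Section RingDrazin.
Variable R : pzRingType.
Implicit Types a b d e g n y : R.

Definition right_regular k a := exists y, a ^+ k = a ^+ k.+1 * y.

(** The exponent [k] only bounds the index from above, so it can be raised freely. *)
Definition drazin_inv k a d :=
  [/\ a ^+ k.+1 * d = a ^+ k, d * a * d = d & a * d = d * a].

Lemma right_regular_le j k a :
  (j <= k)%N -> right_regular j a -> right_regular k a.
Proof.
move=> /subnKC <- [y ay]; exists y.
by rewrite addnC -addnS !exprD -mulrA -ay.
Qed.

Lemma drazin_inv_le j k a d :
  (j <= k)%N -> drazin_inv j a d -> drazin_inv k a d.
Proof.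
move=> /subnKC <- [ad dad c]; split=> //.
by rewrite addnC -addnS !exprD -mulrA ad.
Qed.

Lemma drazin_inv_regular k a d : drazin_inv k a d -> right_regular k a.
Proof. by case=> ad _ _; exists d. Qed.

(** [a * d] is idempotent with commuting factors, so it equals each of its positive powers. *)
Lemma drazin_inv_mulX j k a d :
  drazin_inv k a d -> a * d = a ^+ j.+1 * d ^+ j.+1.
Proof.
case=> _ dad c; rewrite -exprMn_comm //; elim: j => // j IH.
by rewrite exprS -IH mulrA -(mulrA a) -mulrA dad.
Qed.

Lemma drazin_inv_commX j k a d :
  drazin_inv k a d -> a ^+ j * d = d * a ^+ j.
Proof. by case=> _ _ c; apply/esym/commrX/esym. Qed.

(* The idempotents [a * d] and [a * e] absorb each other. *)
Lemma drazin_inv_uniq k l a d e :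
  drazin_inv k a d -> drazin_inv l a e -> d = e.
Proof.
move=> hd he.
(* Both exponents are raised to a common positive value, the form in which [drazin_inv_mulX]
   supplies powers. *)
have {}hd : drazin_inv (k + l).+1 a d.
  by apply: drazin_inv_le hd; rewrite -addnS leq_addr.
have {}he : drazin_inv (k + l).+1 a e.
  by apply: drazin_inv_le he; rewrite -addSn leq_addl.
have [ad dad cd] := hd; have [ae eae ce] := he.
have q_p : a * e * (a * d) = a * d.
  rewrite (drazin_inv_mulX (k + l) hd) mulrA; congr (_ * _).
  by rewrite -[in RHS]ae (drazin_inv_commX _ he) ce -mulrA -exprS.
have p_q : a * e * (a * d) = a * e.
  rewrite (drazin_inv_mulX (k + l) he).
  have -> : a ^+ (k + l).+1 * e ^+ (k + l).+1 = e ^+ (k + l).+1 * a ^+ (k + l).+1.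
    exact/commrX/(drazin_inv_commX _ he).
  by rewrite -mulrA; congr (_ * _); rewrite mulrA -exprSr ad.
have pq : a * d = a * e by rewrite -q_p.
(* d = d a d = d a e = a d e = a e e = e a e = e. *)
by rewrite -dad -mulrA pq mulrA -cd pq ce eae.
Qed.

Lemma right_regularX i k a y :
  a ^+ k = a ^+ k.+1 * y -> a ^+ k = a ^+ (i + k) * y ^+ i.
Proof.
move=> ay; elim: i => [|i IH]; first by rewrite mulr1.
by rewrite {1}IH exprD ay mulrA -exprD addnS [y ^+ i.+1]exprS mulrA.
Qed.

(** Lowers the exponent to any [k] at which [a] is regular: [a * d] fixes a^(j+k), hence also a^k =
    a^(j+k) y^j. *)
Lemma right_regular_drazin_inv j k a d :
  right_regular k a -> drazin_inv j a d -> drazin_inv k a d.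
Proof.
move=> [y ay] /(drazin_inv_le (leq_addr k j)) hd; have [ad dad c] := hd.
split=> //.
rewrite exprS -mulrA (drazin_inv_commX k hd) (right_regularX j ay) !mulrA -(mulrA a d).
by rewrite -(drazin_inv_commX (j + k) hd) mulrA -exprS ad.
Qed.

Lemma comm_regular_drazin_inv k a y :
  a * y = y * a -> a ^+ k = a ^+ k.+1 * y -> drazin_inv k a (a ^+ k * y ^+ k.+1).
Proof.
move=> c ay.
have cX i j : a ^+ i * y ^+ j = y ^+ j * a ^+ i.
  by apply/commrX/esym/commrX/esym.
have ad : a ^+ k.+1 * (a ^+ k * y ^+ k.+1) = a ^+ k.
  by rewrite mulrA -exprD -(right_regularX _ ay).
have cd : a * (a ^+ k * y ^+ k.+1) = a ^+ k * y ^+ k.+1 * a.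
  by rewrite mulrA -exprS -mulrA -(cX 1%N) mulrA -exprSr.
split=> //; set d := a ^+ k * y ^+ k.+1 in ad cd *.
have dX : a ^+ k * d = d * a ^+ k by apply/esym/commrX/esym.
(* d a d = a d d = a^(k+1) d y^(k+1) = a^k y^(k+1) = d. *)
by rewrite -cd {2}/d mulrA -(mulrA a) -dX mulrA -exprS ad.
Qed.

(** [g] has a factor [b] on either side, so [n] annihilates it. Positive powers of b + n split as
    sums, and n^(m+1) vanishes, so a^(m+1) = b^(m+1). *)
Lemma core_part_drazin_inv m a b n g :
  a = b + n -> n * b = 0 -> b * n = 0 -> n ^+ m.+1 = 0 ->
  drazin_inv 1 b g -> drazin_inv m.+1 a g /\ a * g * a = b.
Proof.
move=> -> nb bn nm [bg gbg c]; rewrite expr2 expr1 in bg.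
have gE : g = b * g * g by rewrite c gbg.
have ng : n * g = 0 by rewrite gE !mulrA nb !mul0r.
have gE' : g = g * g * b by rewrite -mulrA -c mulrA gbg.
have gn : g * n = 0 by rewrite gE' -!mulrA bn !mulr0.
have aX i : (b + n) ^+ i.+1 = b ^+ i.+1 + n ^+ i.+1.
  elim: i => // i IH.
  by rewrite exprS IH mulrDl !mulrDr -!exprS [b ^+ i.+1]exprS [n ^+ i.+1]exprS
    !(mulrA b, mulrA n) nb bn !mul0r addr0 add0r.
split; last by rewrite mulrDl ng addr0 mulrDr -!mulrA gn mulr0 addr0 -c mulrA bg.
split.
- rewrite 2!aX [n ^+ m.+2]exprS nm mulr0 !addr0 2!exprSr -!mulrA (mulrA b b g) bg.
  by rewrite -exprSr.
- by rewrite mulrDr gn addr0.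
- by rewrite mulrDl mulrDr ng gn c.
Qed.

(** * Core and nilpotent parts built from a Drazin inverse *)

Section DrazinPair.
Variables (k : nat) (a d : R).
Hypothesis hd : drazin_inv k a d.

Let comm_idem : a * (a * d) = a * d * a.
Proof. by case: hd => _ _ c; rewrite {1}c mulrA. Qed.

Let core_d : a * d * a * d = a * d.
Proof. by case: hd => _ dad _; rewrite -!mulrA (mulrA d) dad. Qed.

Let d_core : d * (a * d * a) = a * d.
Proof. by case: hd => _ dad c; rewrite !mulrA dad c. Qed.

Let core_idem : a * d * a * (a * d) = a * (a * d).
Proof. by rewrite -mulrA comm_idem !mulrA core_d. Qed.

Lemma drazin_inv_core : drazin_inv 1 (a * d * a) d.
Proof.
case: hd => _ dad c; split; last by rewrite core_d d_core.
- by rewrite expr2 expr1 -mulrA core_d core_idem comm_idem.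
- by rewrite d_core c dad.
Qed.

(** With [drazin_inv_core], the core part and [d] are group inverses of each other; this direction
    yields the final claim on the group inverse of the Drazin inverse. *)
Lemma drazin_inv_core_sym : drazin_inv 1 d (a * d * a).
Proof.
case: hd => _ dad c; split; last by rewrite core_d d_core.
- by rewrite expr2 expr1 -mulrA d_core mulrA dad.
- by rewrite core_d !mulrA core_d.
Qed.

Lemma nilp_mul_core : (a - a * d * a) * (a * d * a) = 0.
Proof.
by rewrite mulrBl (mulrA a (a * d)) (mulrA (a * d * a) (a * d)) core_idem subrr.
Qed.

Lemma core_mul_nilp : a * d * a * (a - a * d * a) = 0.
Proof. by rewrite mulrBr (mulrA _ (a * d)) core_idem comm_idem subrr. Qed.

(** The nilpotent part is (1 - a d) a with commuting factors, and 1 - a d kills a^(k+1). The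
    exponent k + 1 is positive even for k = 0. *)
Lemma nilp_partX : (a - a * d * a) ^+ k.+1 = 0.
Proof.
have [ad _ _] := hd.
have -> : a - a * d * a = (1 - a * d) * a by rewrite mulrBl mul1r.
rewrite exprMn_comm; last first.
  by rewrite /GRing.comm mulrBl mulrBr mul1r mulr1 comm_idem.
rewrite exprSr -mulrA mulrBl mul1r.
have -> : a * d * a ^+ k.+1 = a ^+ k.+1.
  by rewrite -mulrA -(drazin_inv_commX k.+1 hd) ad -exprS.
by rewrite subrr mulr0.
Qed.

(** Regularity at 0 is right invertibility. A right invertible core part forces the nilpotent part,
    whose product with it is 0, to vanish. *)
Lemma core_regular0 : right_regular 0 (a * d * a) -> right_regular 0 a.
Proof.
case=> y; rewrite expr0 expr1 => b1; exists y; rewrite expr0 expr1.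
suff aE : a = a * d * a by rewrite [LHS]b1 -aE.
by apply/eqP; rewrite -subr_eq0 -[_ - _]mulr1 b1 mulrA nilp_mul_core mul0r.
Qed.

Lemma drazin_regular0 : right_regular 0 d -> right_regular 0 a.
Proof.
have [_ dad c] := hd.
case=> y; rewrite expr0 expr1 => d1; exists d; rewrite expr0 expr1.
by rewrite c [LHS]d1 -[X in X * y]dad -mulrA -d1 mulr1.
Qed.

End DrazinPair.
End RingDrazin.

(** * Regularity of square matrices over a field *)

Lemma mx_comm_regular (F : fieldType) (n : nat) (a : 'M[F]_n) :
  exists k y, a * y = y * a /\ a ^+ k = a ^+ k.+1 * y.
Proof.
case: n a => [|n] a; first by exists 0, 0; rewrite [a]flatmx0 !flatmx0.
(* The characteristic polynomial is q X^m with q(0) nonzero. Writing q = r X + c with c = q(0),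
   Cayley-Hamilton gives c a^m = - r(a) a^(m+1). *)
have [m [q q0 char_q]] := multiplicity_XsubC (char_poly a) 0.
have {q0} : ~~ root q 0 by rewrite (monic_neq0 (char_poly_monic a)) in q0.
elim/poly_ind: q char_q => [|r c _]; first by rewrite root0.
rewrite /root hornerMXaddC mulr0 add0r subr0 => char_q c0.
have := Cayley_Hamilton a; rewrite char_q rmorphM rmorphD rmorphM rmorphXn /=.
rewrite horner_mx_X horner_mx_C => ra.
pose r' := horner_mx a r.
have cr : a * r' = r' * a by apply/esym/comm_horner_mx.
exists m, (- c^-1 *: r'); split; first by rewrite -scalerAr -scalerAl cr.
apply: (scalerI c0); rewrite -scalerAr scalerA mulrN divff // scaleN1r.
have -> : a ^+ m.+1 * r' = r' * a * a ^+ m.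
  by rewrite -mulrA -exprS; apply/esym/commrX/esym.
by apply/eqP; rewrite -addr_eq0 addrC -ra mulrDl -mul_scalar_mx.
Qed.

(** * Transfer between tensors and matrices *)

Section TensorMatrix.
Variables (F : fieldType) (N : nat).
Implicit Types I J K : 'I_N -> nat.

(** The columns of [A] are the images of the unit hypermatrices; chosen preimages of them under [B]
    are the columns of [Y]. *)
Lemma trange_subP I J K (A : tensor F I K) (B : tensor F I J) :
  (range (tapply A) `<=` range (tapply B))%classic <-> exists Y, A = einstein B Y.
Proof.
split=> [sAB | [Y ->] _ [X _ <-]].
- have /choice[Z BZ] (k : mindex K) : exists Z : hyper F J,
      tapply B Z = [ffun i => A (i, k)].
    have [|Z _ BZ] := sAB [ffun i => A (i, k)]; last by exists Z.
    exists [ffun j => (j == k)%:R] => //; apply/ffunP => i; rewrite !ffunE.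
    rewrite (bigD1 k) //= ffunE eqxx mulr1 big1 ?addr0 // => j /negPf jk.
    by rewrite ffunE jk mulr0.
  exists [ffun p => Z p.2 p.1]; apply/ffunP => -[i k]; rewrite ffunE /=.
  have /ffunP/(_ i) := BZ k; rewrite !ffunE => <-.
  by apply: eq_bigr => j _; rewrite ffunE.
- exists (tapply Y X) => //; apply/ffunP => i; rewrite !ffunE.
  under eq_bigr do rewrite ffunE mulr_sumr.
  rewrite exchange_big; apply: eq_bigr => k _; rewrite ffunE mulr_suml.
  by apply: eq_bigr => j _; rewrite mulrA.
Qed.

Variable I : 'I_N -> nat.
Implicit Types A B X : tensor F I I.

Definition mx_of_tensor A : 'M[F]_#|mindex I| :=
  \matrix_(i, j) A (enum_val i, enum_val j).

Definition tensor_of_mx (M : 'M[F]_#|mindex I|) : tensor F I I :=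
  [ffun p => M (enum_rank p.1) (enum_rank p.2)].

Lemma mx_of_tensorK : cancel mx_of_tensor tensor_of_mx.
Proof. by move=> A; apply/ffunP => -[i j]; rewrite ffunE mxE !enum_rankK. Qed.

Lemma tensor_of_mxK : cancel tensor_of_mx mx_of_tensor.
Proof. by move=> M; apply/matrixP => i j; rewrite mxE ffunE !enum_valK. Qed.

Let phi_inj := can_inj mx_of_tensorK.

Lemma mx_of_tensorM A B :
  mx_of_tensor (einstein A B) = mx_of_tensor A * mx_of_tensor B.
Proof.
apply/matrixP => i j; rewrite !mxE ffunE.
rewrite (reindex _ (onW_bij _ (enum_val_bij (mindex I)))) /=.
by apply: eq_bigr => k _; rewrite !mxE.
Qed.

Lemma mx_of_tensorD A B : mx_of_tensor (A + B) = mx_of_tensor A + mx_of_tensor B.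
Proof. by apply/matrixP => i j; rewrite !mxE ffunE. Qed.

Lemma mx_of_tensor0 : mx_of_tensor 0 = 0.
Proof. by apply/matrixP => i j; rewrite !mxE ffunE. Qed.

Lemma mx_of_tensor1 : mx_of_tensor (tid F I) = 1.
Proof.
by apply/matrixP => i j; rewrite !mxE ffunE /= (inj_eq enum_val_inj).
Qed.

Lemma mx_of_tensorX A k : mx_of_tensor (tpow A k) = mx_of_tensor A ^+ k.
Proof.
elim: k => [|k IH]; first exact: mx_of_tensor1.
by rewrite /= mx_of_tensorM IH exprS.
Qed.

(** The ranges of the powers always decrease, so equality amounts to the reverse inclusion, that is,
    to a factorization. *)
Lemma trange_right_regular A k :
  trange (tpow A k) = trange (tpow A k.+1) <-> right_regular k (mx_of_tensor A).
Proof.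
have down : (trange (tpow A k.+1) `<=` trange (tpow A k))%classic.
  apply/trange_subP; exists A; apply: phi_inj.
  by rewrite mx_of_tensorM !mx_of_tensorX exprSr.
split=> [eqA | [y Ay]].
- have /trange_subP[Y AY] : (trange (tpow A k) `<=` trange (tpow A k.+1))%classic.
    by rewrite eqA.
  by exists (mx_of_tensor Y); rewrite -!mx_of_tensorX -mx_of_tensorM -AY.
- apply/seteqP; split=> //; apply/trange_subP; exists (tensor_of_mx y).
  by apply: phi_inj; rewrite mx_of_tensorM !mx_of_tensorX tensor_of_mxK.
Qed.

Lemma drazin_inv_exists A k :
  right_regular k (mx_of_tensor A) ->
  exists X, drazin_inv k (mx_of_tensor A) (mx_of_tensor X).
Proof.
move=> Ak; have [m [y [c Ay]]] := mx_comm_regular (mx_of_tensor A).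
have := right_regular_drazin_inv Ak (comm_regular_drazin_inv c Ay).
by rewrite -[X in drazin_inv _ _ X]tensor_of_mxK; eexists; eassumption.
Qed.

(** Some exponent is regular by [mx_comm_regular], and the least one is the index; so the default of
    [xget] does not arise. *)
Lemma tindexP A : is_index A (tindex A).
Proof.
apply: xgetPex.
have ex : exists k, `[< right_regular k (mx_of_tensor A) >].
  have [k [y [_ Ay]]] := mx_comm_regular (mx_of_tensor A).
  by exists k; apply/asboolP; exists y.
exists (ex_minn ex); case: ex_minnP => k /asboolP Ak k_min.
split=> [|j]; first exact/trange_right_regular.
rewrite ltnNge => /negP nkj /trange_right_regular Aj.
by apply/nkj/k_min/asboolP.
Qed.

Lemma tindex_le A k :
  (tindex A <= k)%N <-> right_regular k (mx_of_tensor A).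
Proof.
have [/trange_right_regular A_ind A_min] := tindexP A.
split=> [ik | Ak]; first exact: right_regular_le ik A_ind.
by rewrite leqNgt; apply/negP => /A_min; apply; apply/trange_right_regular.
Qed.

Lemma is_drazinE A X :
  is_drazin A X <-> drazin_inv (tindex A) (mx_of_tensor A) (mx_of_tensor X).
Proof.
split=> -[e1 e2 e3]; split.
- by rewrite -!mx_of_tensorX -mx_of_tensorM e1.
- by rewrite -!mx_of_tensorM e2.
- by rewrite -!mx_of_tensorM e3.
- by apply: phi_inj; rewrite mx_of_tensorM !mx_of_tensorX.
- by apply: phi_inj; rewrite !mx_of_tensorM.
- by apply: phi_inj; rewrite !mx_of_tensorM.
Qed.

Lemma drazinP A :
  drazin_inv (tindex A) (mx_of_tensor A) (mx_of_tensor (drazin A)).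
Proof.
have /drazin_inv_exists[X AX] := (tindex_le A (tindex A)).1 (leqnn _).
by apply/is_drazinE; apply: xgetPex; exists X; apply/is_drazinE.
Qed.

(** Since [k] is arbitrary, a Drazin inverse can be recognized without knowing the index. *)
Lemma drazin_unique A X k :
  drazin_inv k (mx_of_tensor A) (mx_of_tensor X) -> drazin A = X.
Proof. by move=> AX; apply/phi_inj/(drazin_inv_uniq (drazinP A) AX). Qed.

(** The right-hand side depends on [A] alone, which gives uniqueness of the decomposition. *)
Lemma core_nilpotent_core A B M :
  core_nilpotent_decomposition A B M ->
  mx_of_tensor B = mx_of_tensor A * mx_of_tensor (drazin A) * mx_of_tensor A.
Proof.
case=> AE B1 [m m_gt0 Mm] MB BM.
have BG := drazin_inv_le B1 (drazinP B).
have aE : mx_of_tensor A = mx_of_tensor B + mx_of_tensor M.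
  by rewrite AE mx_of_tensorD.
have mb : mx_of_tensor M * mx_of_tensor B = 0.
  by rewrite -mx_of_tensorM MB mx_of_tensor0.
have bm : mx_of_tensor B * mx_of_tensor M = 0.
  by rewrite -mx_of_tensorM BM mx_of_tensor0.
have mX : mx_of_tensor M ^+ m.-1.+1 = 0.
  by rewrite prednK // -mx_of_tensorX Mm mx_of_tensor0.
have [AG {1}<-] := core_part_drazin_inv aE mb bm mX BG.
by rewrite (drazin_unique AG).
Qed.

End TensorMatrix.

Theorem theorem3p22 (R : realType) (N : nat) (hN : (0 < N)%N)
    (I : 'I_N -> nat) (hI : forall s : 'I_N, (0 < I s)%N)
    (A : tensor R[i] I I) :
  exists B M : tensor R[i] I I,
    [/\ core_nilpotent_decomposition A B M,
        (forall B' M' : tensor R[i] I I,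
           core_nilpotent_decomposition A B' M' -> B' = B /\ M' = M),
        is_group_inverse (drazin A) B
      & (0 < tindex A)%N -> tindex B = 1%N /\ tindex (drazin A) = 1%N].
Proof.
have dA := drazinP A; set a := mx_of_tensor A in dA.
set d := mx_of_tensor (drazin A) in dA.
pose B := tensor_of_mx (a * d * a); pose M := tensor_of_mx (a - a * d * a).
have BE : mx_of_tensor B = a * d * a by exact: tensor_of_mxK.
have ME : mx_of_tensor M = a - a * d * a by exact: tensor_of_mxK.
have phi_inj := can_inj (@mx_of_tensorK R[i] N I).
have AE : A = B + M by apply: phi_inj; rewrite mx_of_tensorD BE ME addrC subrK.
have B1 : (tindex B <= 1)%N.
  by apply/tindex_le; rewrite BE; exact: drazin_inv_regular (drazin_inv_core dA).
have dB := drazin_inv_core_sym dA; rewrite -BE in dB.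
have D1 : (tindex (drazin A) <= 1)%N.
  by apply/tindex_le; exact: drazin_inv_regular dB.
exists B, M; split.
- split=> //.
  + exists (tindex A).+1 => //; apply: phi_inj.
    by rewrite mx_of_tensorX ME (nilp_partX dA) mx_of_tensor0.
  + by apply: phi_inj; rewrite mx_of_tensorM BE ME (nilp_mul_core dA) mx_of_tensor0.
  + by apply: phi_inj; rewrite mx_of_tensorM BE ME (core_mul_nilp dA) mx_of_tensor0.
- move=> B' M' AB'; have B'E : B' = B.
    by apply: phi_inj; rewrite BE (core_nilpotent_core AB').
  by split=> //; have [AE' _ _ _ _] := AB'; apply: (addrI B); rewrite -AE -B'E.
- by split=> //; exact: drazin_unique dB.
(* Index 0 for [B] or [drazin A] would make [a] right invertible, contradicting the positive index
   of [A]. *)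
- move=> A_gt0; have nA : ~ right_regular 0 a.
    by move/tindex_le; rewrite leqNgt A_gt0.
  have pos (X : tensor R[i] I I) :
      (right_regular 0 (mx_of_tensor X) -> right_regular 0 a) ->
      (tindex X <= 1)%N -> tindex X = 1%N.
    move=> X0 X1; apply/eqP; rewrite eqn_leq X1 ltnNge; apply/negP.
    by move/tindex_le/X0.
  split; apply: pos => //; first by rewrite BE; exact: core_regular0 dA.
  exact: drazin_regular0 dA.
Qed.
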